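(* Let $G$ be a connected weighted graph of order $n\ge3$ and let $\mathcal P=\{V_1,\dots,V_m\}$ be a partition of $V(G)$ into $m$ nonempty parts, where $2\le m\le n-1$. Then $$K(G)\ \ge\ F_m\bigl(\operatorname{NCut}(\mathcal P)\bigr),\qquad\text{where}\quad F_m(x)=\frac{(m-1)^2}{x}+\frac{(n-m)^2}{n-x}\quad(0<x<n).$$
   Context: Graphs are finite, simple, connected, undirected and weighted: $G=(V,E,c)$ with symmetric weights $c(i,j)=c_{ij}=c_{ji}>0$ if $\{i,j\}\in E$ and $c_{ij}=0$ otherwise (no loops), $|V|=n$. The degree of vertex $i$ is $k_i=\sum_j c_{ij}$, $D=\operatorname{diag}(k_1,\dots,k_n)$, $A=(c_{ij})$ is the adjacency matrix. For $S\subseteq V$ with complement $\bar S$, $\operatorname{vol}(S)=\sum_{i\in S}k_i$ and $\operatorname{cut}(S,\bar S)=\sum_{u\in S,v\in\bar S}c_{uv}$. The normalized cut of the partition is $\operatorname{NCut}(\mathcal P)=\sum_{i=1}^m\frac{\operatorname{cut}(V_i,\bar V_i)}{\operatorname{vol}(V_i)}$. The normalized adjacency matrix is $M_G=D^{-1/2}AD^{-1/2}$, with eigenvalues $1=\lambda_1>\lambda_2\ge\cdots\ge\lambda_n\ge-1$. Kemeny's constant is $K(G)=\sum_i\pi_i m_{ji}-1$ for the random walk with transition matrix $D^{-1}A$, where $\pi$ is the stationary distribution and $m_{ji}$ the mean first passage time from $j$ to $i$ (with $m_{jj}$ the mean first return time); this does not depend on $j$, and it is known that $K(G)=\sum_{j=2}^{n}\frac{1}{1-\lambda_j}$.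 *)

(* Defs.v *)
From HB Require Import structures.
From mathcomp Require Import all_boot all_order all_algebra.
From mathcomp Require Import reals topology normedtype sequences.

Set Implicit Arguments.
Unset Strict Implicit.
Unset Printing Implicit Defensive.

Import Order.TTheory GRing.Theory Num.Theory.
Import numFieldNormedType.Exports.

Local Open Scope ring_scope.

(* The matrix is the adjacency matrix A = (c_ij); the edge set is its support. *)
Record wgraph (R : realType) (n : nat) := WGraph {
  weight :> 'M[R]_n;
  weight_sym : forall i j, weight i j = weight j i;
  weight_ge0 : forall i j, 0 <= weight i j;
  weight_loopless : forall i, weight i i = 0
}.

Definition edge (R : realType) (n : nat) (G : wgraph R n) : rel 'I_n :=
  fun i j => 0 < G i j.

Definition connected_graph (R : realType) (n : nat) (G : wgraph R n) : Prop :=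
  forall i j : 'I_n, connect (edge G) i j.

Definition degree (R : realType) (n : nat) (G : wgraph R n) (i : 'I_n) : R :=
  \sum_j G i j.

Definition degree_mx (R : realType) (n : nat) (G : wgraph R n) : 'M[R]_n :=
  diag_mx (\row_i degree G i).

Definition vol (R : realType) (n : nat) (G : wgraph R n) (S : {set 'I_n}) : R :=
  \sum_(i in S) degree G i.

Definition cut (R : realType) (n : nat) (G : wgraph R n) (S T : {set 'I_n}) : R :=
  \sum_(u in S) \sum_(v in T) G u v.

Definition ncut (R : realType) (n : nat) (G : wgraph R n)
    (P : {set {set 'I_n}}) : R :=
  \sum_(S in P) cut G S (~: S) / vol G S.

Definition transition_mx (R : realType) (n : nat) (G : wgraph R n) : 'M[R]_n :=
  invmx (degree_mx G) *m G.

Definition stationary (R : realType) (n : nat) (Q : 'M[R]_n) (pi : 'rV[R]_n) :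
    Prop :=
  [/\ forall i, 0 <= pi 0 i, \sum_i pi 0 i = 1 & pi *m Q = pi].

(* Probability that the chain started at x visits exactly the states of s,
   in order, at times 1, ..., size s. *)
Fixpoint walk_prob (R : realType) (n : nat) (Q : 'M[R]_n) (x : 'I_n)
    (s : seq 'I_n) : R :=
  if s is y :: s' then Q x y * walk_prob Q y s' else 1.

(* Probability, starting from j, that t is the least time >= 1 at which the
   chain is at i.  The tuple w lists the states at times 1, ..., t, hence the
   shift in the test; for t = 0 the sum is empty.  For j = i this is the law of
   the first return time. *)
Definition first_passage_prob (R : realType) (n : nat) (Q : 'M[R]_n)
    (j i : 'I_n) (t : nat) : R :=
  \sum_(w : t.-tuple 'I_n | (index i w).+1 == t) walk_prob Q j w.

(* The expectation m_ji of the first passage time from j to i. *)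
Definition mean_first_passage (R : realType) (n : nat) (Q : 'M[R]_n)
    (j i : 'I_n) : R :=
  limn (series (fun t : nat => t%:R * first_passage_prob Q j i t)).

(* pi is meant to be the stationary distribution of the walk; the value does not
   depend on the starting vertex j when G is connected. *)
Definition kemeny (R : realType) (n : nat) (G : wgraph R n) (pi : 'rV[R]_n)
    (j : 'I_n) : R :=
  \sum_i pi 0 i * mean_first_passage (transition_mx G) j i - 1.

(* Only meaningful for 0 < x < n. *)
Definition Fbound (R : realType) (n m : nat) (x : R) : R :=
  (m%:R - 1) ^+ 2 / x + (n%:R - m%:R) ^+ 2 / (n%:R - x).

(* Main.v *)
(* Kemeny's constant is [\tr Z - 1] for the fundamental matrix
   [Z = (1 - Q + J)^-1], where [Q = D^-1 A] and [J] has all rows equal to [pi].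
   In the inner product weighted by the degrees, [B = 1 - Q + J] is self-adjoint
   and positive semidefinite, so [Z >= 2 T - T B T] for every self-adjoint [T].
   Let [Pi] be the degree-weighted averaging over the blocks of [P]; then
   [\tr ((1 - Q) Pi)] is the normalized cut [x].  The bound is the trace of this
   inequality at [T = J + a (Pi - J) + b (1 - Pi)] with the optimal choice
   [a = (m - 1) / x], [b = (n - m) / (n - x)].

   The mean first passage times to [i] solve a linear system whose matrix is
   invertible by the maximum principle; its solution bounds the partial sums of
   the defining series, so these converge and the limit is the solution. *)

From HB Require Import structures.
From mathcomp Require Import boolp classical_sets topology normedtype sequences.
From mathcomp Require Import all_boot all_order all_algebra.
From mathcomp Require Import reals ring lra.
Require Import Defs.

Set Implicit Arguments.
Unset Strict Implicit.
Unset Printing Implicit Defensive.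

Import Order.TTheory GRing.Theory Num.Theory.
Import numFieldNormedType.Exports.

Local Open Scope ring_scope.

(** * Stochastic matrices and the chain killed at a state *)

Definition stochastic (R : realType) (n : nat) (Q : 'M[R]_n) : Prop :=
  (forall i j, 0 <= Q i j) /\ (forall i, \sum_j Q i j = 1).

Definition irreducible (R : realType) (n : nat) (Q : 'M[R]_n) : Prop :=
  forall i j, connect (fun x y => 0 < Q x y) i j.

(* The chain killed when it hits i. *)
Definition taboo_mx (R : realType) (n : nat) (Q : 'M[R]_n) (i : 'I_n) : 'M[R]_n :=
  \matrix_(a, b) (Q a b *+ (b != i)).

Lemma taboo_mx_ge0 (R : realType) (n : nat) (Q : 'M[R]_n) (i a b : 'I_n) :
  stochastic Q -> 0 <= taboo_mx Q i a b.
Proof. by move=> [Q0 _]; rewrite mxE mulrn_wge0. Qed.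

Lemma taboo_sum (R : realType) (n : nat) (Q : 'M[R]_n) (i a : 'I_n) (u : 'I_n -> R) :
  \sum_k taboo_mx Q i a k * u k = \sum_(k | k != i) Q a k * u k.
Proof.
rewrite [RHS]big_mkcond; apply: eq_bigr => k _; rewrite mxE.
by case: ifP; rewrite ?mul0r.
Qed.

Lemma taboo_row_sum (R : realType) (n : nat) (Q : 'M[R]_n) (i a : 'I_n) :
  stochastic Q -> \sum_k taboo_mx Q i a k = 1 - Q a i.
Proof.
move=> [_ Q1].
have := taboo_sum Q i a (fun=> 1); under eq_bigr do rewrite mulr1.
move=> ->; under eq_bigr do rewrite mulr1.
by rewrite -(Q1 a) [X in _ = X - _](bigD1 i) //= addrAC subrr add0r.
Qed.

(* Maximum principle: the set where u attains a positive maximum is closed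
   under transitions and transitions from it avoid i. *)
Lemma subharmonic_le0 (R : realType) (n : nat) (Q : 'M[R]_n) (i : 'I_n)
    (u : 'I_n -> R) :
  stochastic Q -> irreducible Q ->
  (forall a, u a <= \sum_k taboo_mx Q i a k * u k) -> forall a, u a <= 0.
Proof.
move=> [Q0 Q1] Qirr usub.
case: (arg_maxP u (erefl true : xpredT i)) => j _ jmax a.
apply: le_trans (jmax a isT) _; rewrite leNgt; apply/negP => uj_gt0.
(* The terms [Q x k * (u j - u k *+ (k != i))] are nonnegative and, the rows of [Q] summing to 1,
   add up to at most 0. So each vanishes, and for [y = i] this would force [u j = 0]. *)
have step x y : u x = u j -> 0 < Q x y -> y != i /\ u y = u j.
  move=> ux Qxy.
  have ge0 k : true -> 0 <= Q x k * (u j - u k *+ (k != i)).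
    move=> _; apply: mulr_ge0 => //; rewrite subr_ge0.
    by case: (k != i); [exact: jmax | exact: ltW].
  have sum0 : \sum_k Q x k * (u j - u k *+ (k != i)) = 0.
    apply/eqP; rewrite eq_le sumr_ge0 // andbT.
    under eq_bigr do rewrite mulrBr.
    rewrite sumrB -mulr_suml Q1 mul1r subr_le0 -{1}ux.
    apply: le_trans (usub x) _; rewrite le_eqVlt; apply/orP; left; apply/eqP.
    apply: eq_bigr => k _; rewrite mxE.
    by case: (k != i); rewrite ?mulr1n // mul0r mulr0n mulr0.
  have/eqP := psumr_eq0P ge0 sum0 (erefl : xpredT y).
  rewrite mulf_eq0 gt_eqF //= subr_eq0.
  by case: (y =P i) => [_ | _] /eqP; rewrite ?mulr0n ?mulr1n => e //; lra.
have reach x y : u x = u j -> connect (fun x y => 0 < Q x y) x y ->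
    u y = u j /\ (y != i \/ y = x).
  move=> ux /connectP[p]; elim: p x ux => [|z p IHp] x ux /=.
    by move=> _ ->; split; [|right].
  move=> /andP[Qxz pz] yE; have [zi uz] := step _ _ ux Qxz.
  have [-> h] := IHp z uz pz yE; split=> //; left.
  by case: h => [//|->].
(* The path from [j] to [i] may be empty, so [i] is first left by one step, to some [k != i]; the
   path from [k] back to [i] is then nonempty and contradicts [reach]. *)
have [ui _] := reach j i erefl (Qirr j i).
have [k Qik] : exists k, 0 < Q i k.
  apply/existsP; rewrite -[X in is_true X]negbK negb_exists; apply/negP => /forallP h.
  have : \sum_k Q i k = 0.
    by apply: big1 => k _; apply/eqP; rewrite eq_le Q0 andbT leNgt h.
  by rewrite Q1 => /eqP; rewrite oner_eq0.
have [ki uk] := step _ _ ui Qik.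
have [_ [/eqP//|ik]] := reach k i uk (Qirr k i).
by rewrite ik eqxx in ki.
Qed.

(** If [v] is fixed by the taboo matrix, the maximum principle applies to both [v] and [- v], so
    [v = 0]. *)
Lemma taboo_unitmx (R : realType) (n : nat) (Q : 'M[R]_n) (i : 'I_n) :
  stochastic Q -> irreducible Q -> 1%:M - taboo_mx Q i \in unitmx.
Proof.
move=> Qst Qirr; rewrite -unitmx_tr -row_free_unit; apply: inj_row_free => v.
move/(congr1 trmx); rewrite trmx_mul trmxK trmx0 mulmxBl mul1mx => /eqP.
rewrite subr_eq0 => /eqP vE.
have vE' a : v 0 a = \sum_k taboo_mx Q i a k * v 0 k.
  move/matrixP/(_ a 0): vE; rewrite !mxE => ->.
  by apply: eq_bigr => k _; rewrite [v^T _ _]mxE.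
apply/rowP => a; rewrite mxE; apply/eqP; rewrite eq_le; apply/andP; split.
  by apply: (subharmonic_le0 Qst Qirr (i := i)) => b; rewrite -vE'.
rewrite -oppr_le0.
apply: (subharmonic_le0 (u := fun a => - v 0 a) Qst Qirr (i := i)) => b.
by rewrite {1}vE' -sumrN ler_sum // => k _; rewrite mulrN.
Qed.

(** [h] will dominate the partial sums of the passage-time series; it is nonnegative because [- h]
    is subharmonic. *)
Lemma taboo_potential (R : realType) (n : nat) (Q : 'M[R]_n) (i : 'I_n) :
  stochastic Q -> irreducible Q ->
  exists h : 'I_n -> R, (forall a, 0 <= h a) /\
    (forall a, h a = 1 + \sum_k taboo_mx Q i a k * h k).
Proof.
move=> Qst Qirr.
pose h : 'cV[R]_n := invmx (1%:M - taboo_mx Q i) *m const_mx 1.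
have hE a : h a 0 = 1 + \sum_k taboo_mx Q i a k * h k 0.
  have : (1%:M - taboo_mx Q i) *m h = const_mx 1.
    by rewrite mulmxA mulmxV ?mul1mx // taboo_unitmx.
  rewrite mulmxBl mul1mx => /matrixP/(_ a 0); rewrite !mxE.
  by move=> /eqP; rewrite subr_eq => /eqP.
exists (fun a => h a 0); split=> // a.
rewrite -oppr_le0.
apply: (subharmonic_le0 (u := fun a => - h a 0) Qst Qirr (i := i)) => b.
rewrite {1}hE opprD -sumrN.
by under eq_bigr do rewrite -mulrN; rewrite gerDr oppr_le0 ler01.
Qed.

(** * First passage probabilities and mean passage times *)

Lemma walk_prob_ge0 (R : realType) (n : nat) (Q : 'M[R]_n) (a : 'I_n)
    (s : seq 'I_n) : stochastic Q -> 0 <= walk_prob Q a s.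
Proof.
by move=> [Q0 _]; elim: s a => [|b s IHs] a //=; rewrite mulr_ge0.
Qed.

Lemma first_passage_prob_ge0 (R : realType) (n : nat) (Q : 'M[R]_n)
    (j i : 'I_n) (t : nat) : stochastic Q -> 0 <= first_passage_prob Q j i t.
Proof. by move=> Qst; apply: sumr_ge0 => w _; apply: walk_prob_ge0. Qed.

Lemma first_passage_prob0 (R : realType) (n : nat) (Q : 'M[R]_n) (j i : 'I_n) :
  first_passage_prob Q j i 0 = 0.
Proof. by apply: big1 => w; rewrite tuple0. Qed.

(** First-step decomposition: a first step to [i] completes the passage at time 1 and at no other
    time, while a step to [k != i] restarts it from [k] with one unit of time less. *)
Lemma first_passage_probS (R : realType) (n : nat) (Q : 'M[R]_n) (j i : 'I_n)
    (t : nat) :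
  first_passage_prob Q j i t.+1 =
  Q j i *+ (t == 0%N) + \sum_k taboo_mx Q i j k * first_passage_prob Q k i t.
Proof.
rewrite /first_passage_prob.
pose h (p : 'I_n * t.-tuple 'I_n) : t.+1.-tuple 'I_n := [tuple of p.1 :: p.2].
have hK : {on [pred w : t.+1.-tuple 'I_n | (index i w).+1 == t.+1], bijective h}.
  exists (fun w => (thead w, [tuple of behead w])) => [[a w] _ | w _].
    by congr (_, _) => //; apply: val_inj.
  by rewrite /h /= -tuple_eta.
rewrite (reindex h hK) /=.
rewrite -(pair_big_dep xpredT (fun a (w : t.-tuple 'I_n) =>
  (if a == i then 0 else (index i w).+1).+1 == t.+1)
  (fun a w => Q j a * walk_prob Q a w)) /=.
rewrite (bigD1 i) //= eqxx taboo_sum; congr (_ + _).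
  case: t h hK => [|t] h hK /=.
    rewrite (big_pred1 [tuple]) ?mulr1 ?mulr1n // => w; apply/esym/eqP; exact: tuple0.
  by rewrite big_pred0.
apply: eq_bigr => k /negPf ki; rewrite ki mulr_sumr.
by apply: eq_bigl => w; rewrite eqSS.
Qed.

Lemma cvg_taboo (R : realType) (n : nat) (Q : 'M[R]_n) (i a : 'I_n)
    (u : nat -> 'I_n -> R) (l : 'I_n -> R) :
  (forall k, (u N k @[N --> \oo] --> l k)%classic) ->
  (\sum_k taboo_mx Q i a k * u N k @[N --> \oo] -->
   \sum_k taboo_mx Q i a k * l k)%classic.
Proof.
move=> ul; apply: cvg_big => //; first exact: add_continuous.
by move=> k _; apply: cvgMl_tmp.
Qed.

Lemma nonneg_bounded_series_cvg (R : realType) (u : nat -> R) (M : R) :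
  (forall t, 0 <= u t) -> (forall N, series u N <= M) ->
  (series u N @[N --> \oo] --> limn (series u))%classic.
Proof.
move=> u0 uM.
have := @nondecreasing_is_cvgn _ (series u).
apply; first by apply: nondecreasing_series => t _ _; exact: u0.
by exists M => _ [N _ <-]; exact: uM.
Qed.

Lemma mean_first_passage_rec (R : realType) (n : nat) (Q : 'M[R]_n) (i j : 'I_n) :
  stochastic Q -> irreducible Q ->
  mean_first_passage Q j i =
  1 + \sum_(k | k != i) Q j k * mean_first_passage Q k i.
Proof.
move=> Qst Qirr; have [h [h0 hE]] := taboo_potential i Qst Qirr.
pose f a t := first_passage_prob Q a i t.
have f0 a t : 0 <= f a t by exact: first_passage_prob_ge0.
pose g a t : R := t%:R * f a t.
have g0 a t : 0 <= g a t by rewrite mulr_ge0.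
have FS a N : series (f a) N.+2 =
    Q a i + \sum_k taboo_mx Q i a k * series (f k) N.+1.
  rewrite /series /= big_nat_recl // [f a 0]first_passage_prob0 add0r.
  under eq_bigr do rewrite [f a _]first_passage_probS.
  rewrite big_split /= big_nat_recl //= mulr1n big1 ?addr0; last by [].
  congr (_ + _); rewrite exchange_big /=.
  by apply: eq_bigr => k _; rewrite mulr_sumr.
(* Split the time [t.+1] as [t] plus 1: the unit collects the passage probabilities themselves, and
   the factor [t] kills the boundary term [Q a i], present only at [t = 0]. *)
have GS a N : series (g a) N.+2 =
    Q a i + \sum_k taboo_mx Q i a k * series (f k) N.+1
     + \sum_k taboo_mx Q i a k * series (g k) N.+1.
  rewrite -FS /series /= big_nat_recl // {1}/g mul0r add0r.
  rewrite [X in _ = X + _]big_nat_recl // [f a 0]first_passage_prob0 add0r.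
  under [X in _ = _ + X]eq_bigr do rewrite mulr_sumr.
  rewrite exchange_big /= -big_split /=; apply: eq_big_nat => t _.
  rewrite /g -addn1 natrD mulrDl mul1r addrC; congr (_ + _).
  rewrite addn1 [f a _]first_passage_probS.
  case: t => [|t]; first by rewrite mul0r big1 // => k _; rewrite mul0r mulr0.
  rewrite mulr0n add0r mulr_sumr; apply: eq_bigr => k _; exact: mulrCA.
have F1 N a : series (f a) N.+1 <= 1.
  elim: N a => [|N IHN] a.
    by rewrite /series /= big_nat1 [f a 0]first_passage_prob0 ler01.
  rewrite FS -lerBrDl -(taboo_row_sum i a Qst); apply: ler_sum => k _.
  by rewrite ler_piMr // taboo_mx_ge0.
have Gh N a : series (g a) N.+1 <= h a.
  elim: N a => [|N IHN] a.
    by rewrite /series /= big_nat1 /g mul0r.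
  rewrite GS hE lerD //; first by rewrite -FS F1.
  by apply: ler_sum => k _; rewrite ler_wpM2l // taboo_mx_ge0.
have Fcvg a : (series (f a) N @[N --> \oo] --> limn (series (f a)))%classic.
  apply: (@nonneg_bounded_series_cvg _ _ 1) => // -[|N] //.
  by rewrite /series /= big_geq.
have Gcvg a : (series (g a) N @[N --> \oo] --> limn (series (g a)))%classic.
  apply: (@nonneg_bounded_series_cvg _ _ (h a)) => // -[|N] //.
  by rewrite /series /= big_geq.
have shift (u : nat -> R) (l : R) (k : nat) :
    (u N @[N --> \oo] --> l -> u (N + k)%N @[N --> \oo] --> l)%classic.
  by move=> ul; rewrite (cvg_shiftn k u).
have uniq_lim (u : nat -> R) (l1 l2 : R) :
    (u N @[N --> \oo] --> l1 ->
     u N @[N --> \oo] --> l2 -> l1 = l2)%classic.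
  move=> u1 u2.
  by rewrite -(cvg_lim (@Rhausdorff R) u1) (cvg_lim (@Rhausdorff R) u2).
have FE a : limn (series (f a)) =
    Q a i + \sum_k taboo_mx Q i a k * limn (series (f k)).
  apply: (uniq_lim _ _ _ (shift _ _ 2%N (Fcvg a))).
  under eq_fun do rewrite addn2 FS -addn1.
  apply: cvgD; first exact: cvg_cst.
  by apply: cvg_taboo => k; apply: shift.
(* Passage to [i] is almost sure: the deficit [1 - limn (series (f a))] is fixed by the taboo
   matrix, hence at most 0. This turns the [f] part of [GS] into the constant 1 in the limit. *)
have F1E a : limn (series (f a)) = 1.
  apply/eqP; rewrite eq_le; apply/andP; split.
    apply: limr_le; first by apply: cvgP; exact: Fcvg.
    by exists 1%N => // -[|N].
  rewrite -subr_le0.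
  apply: (subharmonic_le0 (u := fun a => 1 - limn (series (f a))) Qst Qirr
    (i := i)) => b.
  rewrite {1}FE opprD addrA -(taboo_row_sum i b Qst) -sumrB.
  by apply: ler_sum => k _; rewrite mulrBr mulr1.
rewrite -taboo_sum.
apply: (uniq_lim _ _ _ (shift _ _ 2%N (Gcvg j))).
under eq_fun do rewrite addn2 GS -addn1.
apply: cvgD; last by apply: cvg_taboo => k; apply: shift.
rewrite -(F1E j) FE; apply: cvgD; first exact: cvg_cst.
by apply: cvg_taboo => k; apply: shift.
Qed.

(** Kac's formula: when the first-step recursion is averaged over [pi], invariance makes both sides
    agree up to the term [k = i] on the left and the constant 1 on the right. *)
Lemma mean_return_time (R : realType) (n : nat) (Q : 'M[R]_n) (pi : 'rV[R]_n)
    (i : 'I_n) :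
  stochastic Q -> irreducible Q -> stationary Q pi ->
  pi 0 i * mean_first_passage Q i i = 1.
Proof.
move=> Qst Qirr [_ pi1 piQ].
have : \sum_j pi 0 j * mean_first_passage Q j i =
       1 + \sum_(k | k != i) pi 0 k * mean_first_passage Q k i.
  under eq_bigr do rewrite mean_first_passage_rec // mulrDr mulr1 mulr_sumr.
  rewrite big_split /= pi1 exchange_big /=; congr (_ + _).
  apply: eq_bigr => k _; rewrite -[in RHS]piQ mxE mulr_suml.
  by apply: eq_bigr => j _; rewrite mulrA.
by rewrite (bigD1 i) //=; apply: addIr.
Qed.

(** * The fundamental matrix and its trace *)

Lemma mulmx_stationary1 (R : realType) (n : nat) (Q : 'M[R]_n) (pi : 'rV[R]_n) :
  stationary Q pi -> pi *m const_mx 1 = 1%:M :> 'M_1.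
Proof.
move=> [_ pi1 _]; apply/matrixP => a b; rewrite !ord1 !mxE eqxx -[RHS]pi1.
by apply: eq_bigr => k _; rewrite mxE mulr1.
Qed.

Lemma stochastic_mul1 (R : realType) (n : nat) (Q : 'M[R]_n) :
  stochastic Q -> Q *m const_mx 1 = const_mx 1 :> 'cV_n.
Proof.
move=> [_ Q1]; apply/matrixP => a b; rewrite !mxE -[RHS](Q1 a).
by apply: eq_bigr => k _; rewrite mxE mulr1.
Qed.

(* Z is the Kemeny-Snell fundamental matrix; it is obtained from the passage
   times themselves, so its existence needs no separate argument. *)
Lemma fundamental_mx_trace (R : realType) (n : nat) (Q : 'M[R]_n)
    (pi : 'rV[R]_n) :
  stochastic Q -> irreducible Q -> stationary Q pi ->
  exists2 Z : 'M[R]_n, (1%:M - Q + const_mx 1 *m pi) *m Z = 1%:M &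
    forall j, \sum_i pi 0 i * mean_first_passage Q j i = \tr Z.
Proof.
move=> Qst Qirr pist; have pi1 := mulmx_stationary1 pist.
have Q1 := stochastic_mul1 Qst; have [_ _ piQ] := pist.
set one : 'cV[R]_n := const_mx 1 in pi1 Q1 *.
(* With zero diagonal in [X], the first-step recursion gives [- pi 0 i] off the diagonal of
   [(1%:M - Q) *m X], and Kac's formula gives [1 - pi 0 i] on it. *)
pose X := \matrix_(j < n, i < n) - (pi 0 i * mean_first_passage Q j i *+ (j != i)).
have LX : (1%:M - Q) *m X = 1%:M - one *m pi.
  apply/matrixP => j i; rewrite mulmxBl mul1mx !mxE.
  rewrite (big_ord1 _ (fun k => one j k * pi k i)) mxE mul1r.
  have -> : \sum_k Q j k * X k i =
      - (pi 0 i * (mean_first_passage Q j i - 1)).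
    rewrite mean_first_passage_rec // addrAC subrr add0r mulr_sumr -sumrN [RHS]big_mkcond.
    apply: eq_bigr => k _; rewrite mxE mulrN.
    by case: ifP; rewrite ?mulr0n ?mulr0 ?oppr0 // mulr1n mulrCA.
  have := mean_return_time i Qst Qirr pist.
  case: (j =P i) => [->|_] /=; last by move=> _; rewrite !mulr1n mulr0n; ring.
  by rewrite mulrBr => ->; rewrite mulr0n mulr1n; ring.
(* [y] is chosen so that [pi *m Z = pi]; the correction [one *m y] is invisible to [1%:M - Q], which
   kills [one]. *)
have [y yE] : exists y, y = pi - pi *m X by exists (pi - pi *m X).
pose Z := X + one *m y.
have BZ : (1%:M - Q + one *m pi) *m Z = 1%:M.
  rewrite mulmxDl !mulmxDr LX [(1%:M - Q) *m (one *m y)]mulmxA.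
  rewrite mulmxBl mul1mx Q1 subrr mul0mx addr0.
  rewrite -[one *m pi *m (one *m y)]mulmxA [pi *m (one *m y)]mulmxA pi1 mul1mx.
  by rewrite yE mulmxBr mulmxA [X in _ + X = _]addrC subrK subrK.
exists Z => // j.
have Z1 : Z *m one = one.
  have B1 : (1%:M - Q + one *m pi) *m one = one.
    by rewrite mulmxDl mulmxBl mul1mx Q1 subrr add0r -mulmxA pi1 mulmx1.
  by rewrite -{1}B1 mulmxA (mulmx1C BZ) mul1mx.
(* The diagonal of [X] is zero, so only [y] contributes. Row [j] of [Z *m one = one] then gives the
   trace as 1 minus the row sum of [X], and this 1 is the term [i = j] by Kac's formula. *)
have trZ : \tr Z = \sum_i y 0 i.
  apply: eq_bigr => i _; rewrite !mxE eqxx mulr0n oppr0 add0r.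
  by rewrite big_ord1 mxE mul1r.
have : 1 = \sum_i X j i + \sum_i y 0 i.
  move/matrixP/(_ j 0): Z1; rewrite !mxE => <-; rewrite -big_split /=.
  by apply: eq_bigr => i _; rewrite !mxE big_ord1 !mxE mul1r mulr1.
rewrite -trZ => /eqP; rewrite addrC -subr_eq => /eqP <-.
rewrite (bigD1 j) //= mean_return_time //; congr (_ + _).
rewrite [X in - X](bigD1 j) //= mxE eqxx mulr0n oppr0 add0r -sumrN.
by apply: eq_bigr => i ij; rewrite mxE eq_sym ij mulr1n opprK.
Qed.

(** * The trace inequality for self-adjoint matrices *)

(* Completing the square: in the inner product weighted by d one has
   [Z - 2 T + T B T = (Z - T)^* B (Z - T)]. *)
Lemma selfadjoint_inverse_trace_ge (R : realFieldType) (n : nat) (d : 'rV[R]_n)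
    (B T Z : 'M[R]_n) :
  (forall i, 0 < d 0 i) ->
  (diag_mx d *m B)^T = diag_mx d *m B ->
  (forall u : 'cV[R]_n, 0 <= (u^T *m (diag_mx d *m B) *m u) 0 0) ->
  (diag_mx d *m T)^T = diag_mx d *m T ->
  B *m Z = 1%:M ->
  2 * \tr T - \tr (B *m (T *m T)) <= \tr Z.
Proof.
move=> d0; set D := diag_mx d => DBt psd DTt BZ.
pose Y := Z - T.
have DY : Y^T *m (D *m B) *m Y = D *m (Z - T - (T - T *m B *m T)).
  have TtD : T^T *m D = D *m T by rewrite -DTt trmx_mul tr_diag_mx.
  have ZtDB : Z^T *m (D *m B) = D.
    by rewrite -DBt -trmx_mul -mulmxA BZ mulmx1 tr_diag_mx.
  have -> : Y^T *m (D *m B) = D *m (1%:M - T *m B).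
    by rewrite /Y linearB /= mulmxBl ZtDB mulmxA TtD mulmxBr mulmx1 mulmxA.
  rewrite -mulmxA; congr (_ *m _); rewrite mulmxBl mul1mx /Y mulmxBr.
  by rewrite -[T *m B *m Z]mulmxA BZ mulmx1.
(* After multiplication by the positive weight [d 0 i], each diagonal entry is the form of [D *m B]
   at a column of [Y]. *)
have : 0 <= \tr (Z - T - (T - T *m B *m T)).
  apply: sumr_ge0 => i _; rewrite -(pmulr_rge0 _ (d0 i)).
  move/matrixP/(_ i i): DY; rewrite [in RHS]mul_diag_mx [RHS]mxE => <-.
  suff -> : (Y^T *m (D *m B) *m Y) i i = ((col i Y)^T *m (D *m B) *m col i Y) 0 0.
    exact: psd.
  rewrite tr_col -row_mul [LHS]mxE [RHS]mxE; apply: eq_bigr => k _.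
  by rewrite [row _ _ _ _]mxE [col _ _ _ _]mxE.
rewrite !linearB /= -mulmxA mxtrace_mulC -mulmxA; lra.
Qed.

(* [J], [Pi - J] and [1 - Pi] are complementary projections, so [T] is the
   general combination of them that acts as the identity on the image of [J]. *)
Lemma projection_trace (R : realFieldType) (n : nat) (L J Pi : 'M[R]_n)
    (a b : R) (T := J + a *: (Pi - J) + b *: (1%:M - Pi)) :
  L *m J = 0 -> J *m J = J -> Pi *m Pi = Pi -> Pi *m J = J -> J *m Pi = J ->
  \tr J = 1 -> \tr L = n%:R ->
  2 * \tr T - \tr ((L + J) *m (T *m T)) =
  1 + (2 * a * (\tr Pi - 1) - a ^+ 2 * \tr (L *m Pi)) +
  (2 * b * (n%:R - \tr Pi) - b ^+ 2 * (n%:R - \tr (L *m Pi))).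
Proof.
move=> LJ JJ PP PJ JP trJ trL.
have TT : T *m T = J + a ^+ 2 *: (Pi - J) + b ^+ 2 *: (1%:M - Pi).
  rewrite {1}/T !mulmxDl -!scalemxAl.
  have -> : J *m T = J.
    by rewrite !mulmxDr -!scalemxAr !mulmxBr JJ JP mulmx1 subrr !scaler0 !addr0.
  have -> : (Pi - J) *m T = a *: (Pi - J).
    rewrite !mulmxDr -!scalemxAr !mulmxBr !mulmxBl PP JJ PJ JP !mulmx1.
    by rewrite !subrr scaler0 add0r !subr0 addr0.
  have -> : (1%:M - Pi) *m T = b *: (1%:M - Pi).
    rewrite !mulmxDr -!scalemxAr !mulmxBr !mulmxBl PP PJ !mul1mx mulmx1.
    by rewrite !subrr !subr0 scaler0 !add0r.
  by rewrite !scalerA -!expr2.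
have -> : (L + J) *m (T *m T) =
    J + a ^+ 2 *: (L *m Pi) + b ^+ 2 *: (L - L *m Pi).
  rewrite TT !mulmxDr -!scalemxAr !mulmxBr !mulmxDl LJ JJ JP mulmx1 add0r.
  rewrite [L *m Pi + J - J]addrK; congr (_ + _ *: _).
  by rewrite mulmx1 opprD addrACA subrr addr0.
have trN (A : 'M[R]_n) : \tr (- A) = - \tr A by rewrite raddfN.
rewrite /T !(mxtraceD, trN, mxtraceZ) trJ trL mxtrace1; ring.
Qed.

(** * The random walk on a connected graph *)

Section Graph.

Variables (R : realType) (n : nat) (G : wgraph R n).
Hypotheses (n_gt1 : (1 < n)%N) (G_conn : connected_graph G).

(** A path from [x] to [y] must use an edge that leaves [S]. *)
Lemma cut_gt0 (S : {set 'I_n}) (x y : 'I_n) :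
  x \in S -> y \notin S -> 0 < cut G S (~: S).
Proof.
move=> xS yS.
have [u [v [uS vS uv]]] : exists u v, [/\ u \in S, v \notin S & 0 < G u v].
  have /connectP[p] := G_conn x y.
  elim: p x xS => [|z p IHp] x xS /=; first by move=> _ yx; rewrite yx xS in yS.
  move=> /andP[xz pz] yE; have [zS|zS] := boolP (z \in S); first exact: (IHp z).
  by exists x, z.
have inner_ge0 w : 0 <= \sum_(v in ~: S) G w v.
  by apply: sumr_ge0 => *; exact: weight_ge0.
rewrite /cut (bigD1 u) //= ltr_pwDl //; last by apply: sumr_ge0.
rewrite (bigD1 v) ?inE //= ltr_pwDl // sumr_ge0 // => *; exact: weight_ge0.
Qed.

(** The degree bounds the cut of the singleton, whose complement is nonempty because [1 < n]. *)
Lemma degree_gt0 (i : 'I_n) : 0 < degree G i.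
Proof.
have [y yi] : exists y, y \notin [set i].
  have /card_gt1P[x [y [_ _ xy]]] : (1 < #|'I_n|)%N by rewrite card_ord.
  have [xi|xi] := eqVneq x i; last by exists x; rewrite inE.
  by exists y; rewrite inE -xi eq_sym.
have := cut_gt0 (set11 i) yi; rewrite /cut big_set1 => /lt_le_trans; apply.
rewrite /degree [leRHS](bigID (mem (~: [set i]))) /= lerDl.
by apply: sumr_ge0 => *; exact: weight_ge0.
Qed.

Lemma degree_sym (i : 'I_n) : degree G i = \sum_j G j i.
Proof. by apply: eq_bigr => j _; rewrite weight_sym. Qed.

Lemma transition_mxE (i j : 'I_n) : transition_mx G i j = G i j / degree G i.
Proof.
rewrite /transition_mx.
(* [invmx] is a true inverse only on units; positive degrees make [degree_mx G] one. *)
have -> : invmx (degree_mx G) = diag_mx (\row_i (degree G i)^-1).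
  have ED : diag_mx (\row_i (degree G i)^-1) *m degree_mx G = 1%:M.
    apply/matrixP => a b; rewrite mul_diag_mx !mxE.
    by case: eqP => _; rewrite ?mulr0n ?mulr0 // !mulr1n mulVf // gt_eqF // degree_gt0.
  have Du : degree_mx G \in unitmx by case: (mulmx1_unit ED).
  by rewrite -[RHS]mulmx1 -(mulmxV Du) mulmxA ED mul1mx.
by rewrite mul_diag_mx !mxE mulrC.
Qed.

Lemma degree_transition : degree_mx G *m transition_mx G = G.
Proof.
apply/matrixP => a b; rewrite mul_diag_mx [LHS]mxE mxE transition_mxE.
by rewrite mulrC divfK // gt_eqF // degree_gt0.
Qed.

Lemma transition_stochastic : stochastic (transition_mx G).
Proof.
split=> [i j|i]; first by rewrite transition_mxE divr_ge0 ?weight_ge0 // ltW // degree_gt0.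
under eq_bigr do rewrite transition_mxE.
by rewrite -mulr_suml mulfV // gt_eqF // degree_gt0.
Qed.

Lemma transition_irreducible : irreducible (transition_mx G).
Proof.
move=> i j; rewrite (eq_connect (e' := edge G)); first exact: G_conn.
by move=> x y; rewrite /edge transition_mxE pmulr_lgt0 // invr_gt0 degree_gt0.
Qed.

Lemma vol_gt0 (S : {set 'I_n}) (x : 'I_n) : x \in S -> 0 < vol G S.
Proof.
move=> xS; rewrite /vol (bigD1 x) //= ltr_pwDl ?degree_gt0 // sumr_ge0 // => *.
by rewrite ltW // degree_gt0.
Qed.

(** The normalized degrees are stationary by symmetry of the weights. Uniqueness comes from Kac's
    formula: both distributions are inverse to the same mean return time. *)
Lemma stationary_degree (pi : 'rV[R]_n) (i : 'I_n) :
  stationary (transition_mx G) pi -> pi 0 i = degree G i / vol G [set: 'I_n].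
Proof.
have V0 := vol_gt0 (in_setT i); have Vn0 : vol G [set: 'I_n] != 0 by rewrite gt_eqF.
have Qst := transition_stochastic; have Qirr := transition_irreducible.
pose p : 'rV[R]_n := \row_k (degree G k / vol G [set: 'I_n]).
have pst : stationary (transition_mx G) p.
  split=> [k||].
  - by rewrite mxE divr_ge0 ?ltW // degree_gt0.
  - under eq_bigr do rewrite mxE.
    rewrite -mulr_suml -[RHS](mulfV Vn0); congr (_ * _).
    by rewrite /vol; apply: eq_bigl => k; rewrite inE.
  - apply/rowP => k; rewrite !mxE degree_sym mulr_suml; apply: eq_bigr => l _.
    rewrite mxE transition_mxE mulrAC mulrCA.
    by rewrite mulfV ?mulr1 // gt_eqF // degree_gt0.
move=> pist; have mpi := mean_return_time i Qst Qirr pist.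
have mp := mean_return_time i Qst Qirr pst.
have : mean_first_passage (transition_mx G) i i != 0.
  by apply: contra_eq_neq mp => ->; rewrite mulr0 eq_sym oner_eq0.
move/mulIf => inj.
have -> : degree G i / vol G [set: 'I_n] = p 0 i by rewrite mxE.
by apply: inj; rewrite mpi.
Qed.

(** This rank-one form makes symmetry and positivity of the [J] part evident. *)
Lemma degree_rank1 (pi : 'rV[R]_n) :
  stationary (transition_mx G) pi ->
  degree_mx G *m (const_mx 1 *m pi) = vol G [set: 'I_n] *: (pi^T *m pi).
Proof.
move=> pist; apply/matrixP => a b; rewrite mul_diag_mx !mxE !big_ord1 !mxE.
rewrite (stationary_degree a pist) mul1r !mulrA; congr (_ * _).
by rewrite mulrAC divff ?mul1r // lt0r_neq0 // (vol_gt0 (in_setT a)).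
Qed.

(** The form is the Dirichlet energy, half the sum of [G i j * (u i 0 - u j 0) ^+ 2]. *)
Lemma dirichlet_ge0 (u : 'cV[R]_n) :
  0 <= (u^T *m (degree_mx G - weight G) *m u) 0 0.
Proof.
have -> : (u^T *m (degree_mx G - weight G) *m u) 0 0 =
    2^-1 * \sum_i \sum_j G i j * (u i 0 - u j 0) ^+ 2.
  have -> : \sum_i \sum_j G i j * (u i 0 - u j 0) ^+ 2 =
    \sum_i \sum_j G i j * u i 0 ^+ 2 + \sum_i \sum_j G i j * u j 0 ^+ 2
    - 2 * \sum_i \sum_j u i 0 * G i j * u j 0.
    rewrite mulr_sumr -big_split /= -sumrB; apply: eq_bigr => i _.
    rewrite mulr_sumr -big_split /= -sumrB; apply: eq_bigr => j _; ring.
  rewrite [X in _ + X - _]exchange_big /=.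
  under [X in _ + X - _]eq_bigr do rewrite -mulr_suml -degree_sym.
  under [X in X + _ - _]eq_bigr do rewrite -mulr_suml -/(degree G _).
  rewrite mulmxBr mulmxBl mxE [(- _ : 'M__) _ _]mxE.
  have -> : (u^T *m degree_mx G *m u) 0 0 = \sum_i degree G i * u i 0 ^+ 2.
    rewrite -mulmxA mxE; apply: eq_bigr => i _.
    by rewrite mul_diag_mx !mxE mulrCA expr2.
  have -> : (u^T *m weight G *m u) 0 0 = \sum_i \sum_j u i 0 * G i j * u j 0.
    rewrite -mulmxA mxE; apply: eq_bigr => i _.
    by rewrite !mxE mulr_sumr; apply: eq_bigr => j _; rewrite mulrA.
  by field.
rewrite mulr_ge0 ?invr_ge0 // sumr_ge0 // => i _; rewrite sumr_ge0 // => j _.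
by rewrite mulr_ge0 ?sqr_ge0 ?weight_ge0.
Qed.

(** * Averaging over the blocks of a partition *)

Variable P : {set {set 'I_n}}.
Hypothesis hP : partition P [set: 'I_n].

Lemma block_uniq (S T : {set 'I_n}) (x : 'I_n) :
  S \in P -> T \in P -> x \in S -> x \in T -> S = T.
Proof.
move=> SP TP xS xT; case/and3P: hP => _ tP _.
by rewrite -(def_pblock tP SP xS) -(def_pblock tP TP xT).
Qed.

Lemma block_has (S : {set 'I_n}) : S \in P -> exists x, x \in S.
Proof.
move=> SP; apply/set0Pn; apply: contraTneq SP => ->.
by case/and3P: hP.
Qed.

Lemma block_sum1 (x : 'I_n) : \sum_(S in P) (x \in S)%:R = 1 :> R.
Proof.
have [cP tP _] := and3P hP.
have xP : x \in cover P by rewrite (eqP cP) inE.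
rewrite (bigD1 (pblock P x)) ?pblock_mem //= mem_pblock xP big1 ?addr0 //.
move=> S /andP[SP]; case xS: (x \in S) => //.
by rewrite (def_pblock tP SP xS) eqxx.
Qed.

Definition block_col (S : {set 'I_n}) : 'cV[R]_n := \col_i (i \in S)%:R.

(** Applied to a column, this row returns its degree-weighted mean over [S]. *)
Definition block_row (S : {set 'I_n}) : 'rV[R]_n :=
  \row_i ((i \in S)%:R * degree G i / vol G S).

(** The orthogonal projection, for the degree-weighted inner product, onto the functions constant on
    each block. *)
Definition block_proj : 'M[R]_n := \sum_(S in P) block_col S *m block_row S.

Lemma vol_block (S : {set 'I_n}) : \sum_i (i \in S)%:R * degree G i = vol G S.
Proof.
rewrite /vol [RHS]big_mkcond; apply: eq_bigr => i _.
by case: ifP; rewrite ?mul1r ?mul0r.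
Qed.

Lemma block_rowM_col (S T : {set 'I_n}) : S \in P -> T \in P ->
  block_row S *m block_col T = (S == T)%:R%:M.
Proof.
move=> SP TP; apply/matrixP => a b; rewrite !ord1 !mxE eqxx mulr1n.
have [<-|ST] := eqVneq S T; last first.
  apply: big1 => i _; rewrite !mxE; case iS: (i \in S); last by rewrite !mul0r.
  case iT: (i \in T); last by rewrite mulr0.
  by rewrite (block_uniq SP TP iS iT) eqxx in ST.
have [x xS] := block_has SP.
rewrite -[RHS](mulfV (lt0r_neq0 (vol_gt0 xS))) -{1}vol_block mulr_suml.
by apply: eq_bigr => i _; rewrite !mxE; case: (i \in S); rewrite ?mulr1 // !mul0r.
Qed.

Lemma block_row1 (S : {set 'I_n}) : S \in P -> block_row S *m const_mx 1 = 1%:M :> 'M_1.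
Proof.
move=> SP; have [x xS] := block_has SP.
apply/matrixP => a b; rewrite !ord1 !mxE eqxx.
rewrite -[RHS](mulfV (lt0r_neq0 (vol_gt0 xS))) -{1}vol_block mulr_suml.
by apply: eq_bigr => i _; rewrite !mxE mulr1.
Qed.

Lemma block_col_sum : \sum_(S in P) block_col S = const_mx 1.
Proof.
apply/matrixP => a b; rewrite summxE mxE -[RHS](block_sum1 a).
by apply: eq_bigr => S _; rewrite mxE.
Qed.

Lemma block_proj_idem : block_proj *m block_proj = block_proj.
Proof.
rewrite {1}/block_proj mulmx_suml; apply: eq_bigr => S SP.
rewrite -mulmxA; congr (_ *m _); rewrite /block_proj mulmx_sumr (bigD1 S) //=.
rewrite mulmxA block_rowM_col // eqxx mul1mx big1 ?addr0 // => T /andP[TP TS].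
by rewrite mulmxA block_rowM_col // eq_sym (negPf TS) -scalemx1 scale0r mul0mx.
Qed.

Lemma block_proj1 : block_proj *m const_mx 1 = const_mx 1 :> 'cV_n.
Proof.
rewrite -[RHS]block_col_sum mulmx_suml; apply: eq_bigr => S SP.
by rewrite -mulmxA block_row1 // mulmx1.
Qed.

(** Since [pi] is proportional to the degree, its mass on each block is already spread in the way
    the averaging spreads it. *)
Lemma stationary_block_proj (pi : 'rV[R]_n) :
  stationary (transition_mx G) pi -> pi *m block_proj = pi.
Proof.
move=> pist; apply/rowP => i; rewrite /block_proj mulmx_sumr summxE.
rewrite -[RHS]mul1r -(block_sum1 i) mulr_suml; apply: eq_bigr => S SP.
rewrite mulmxA mxE big_ord1 [pi *m _]lock [block_row S _ _]mxE -lock.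
have [x xS] := block_has SP.
have -> : (pi *m block_col S) 0 0 = vol G S / vol G [set: 'I_n].
  rewrite mxE -vol_block mulr_suml; apply: eq_bigr => k _.
  by rewrite mxE (stationary_degree k pist) mulrC mulrA.
rewrite (stationary_degree i pist); field.
by rewrite !gt_eqF // (vol_gt0 xS, vol_gt0 (in_setT i)).
Qed.

Lemma trace_block_proj : \tr block_proj = #|P|%:R.
Proof.
rewrite raddf_sum /= -sum1_card natr_sum; apply: eq_bigr => S SP.
by rewrite mxtrace_mulC block_rowM_col // eqxx mxtrace1.
Qed.

Lemma degree_block_proj_sym :
  (degree_mx G *m block_proj)^T = degree_mx G *m block_proj.
Proof.
apply/matrixP => a b; rewrite mxE !mul_diag_mx !mxE !summxE !mulr_sumr.
apply: eq_bigr => S _; rewrite !mxE !big_ord1 !mxE; ring.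
Qed.

(** By cyclicity of the trace, each block contributes the probability that one step from a vertex of
    [S], drawn in proportion to degree, leaves [S]. *)
Lemma trace_laplacian_block_proj :
  \tr ((1%:M - transition_mx G) *m block_proj) = ncut G P.
Proof.
rewrite mulmx_sumr raddf_sum /=; apply: eq_bigr => S SP.
rewrite mulmxA mxtrace_mulC trace_mx11 mxE.
rewrite /cut mulr_suml [RHS]big_mkcond; apply: eq_bigr => i _.
rewrite [block_row S _ _]mxE; case iS: (i \in S); last by rewrite !mul0r.
rewrite mul1r mulrAC; congr (_ / _).
rewrite mulmxBl mul1mx mulrC !mxE iS mulrBl mul1r mulr_suml.
rewrite [X in _ - X](_ : _ = \sum_(j in S) G i j).
  rewrite /degree [in LHS](bigID (mem S)) /= addrAC subrr add0r.
  by apply: eq_bigl => j; rewrite inE.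
rewrite [RHS]big_mkcond; apply: eq_bigr => j _; rewrite transition_mxE mxE.
case: ifP => _; last by rewrite mulr0 mul0r.
by rewrite mulr1 divfK // gt_eqF // degree_gt0.
Qed.

Lemma cut_le_vol (S : {set 'I_n}) : cut G S (~: S) <= vol G S.
Proof.
apply: ler_sum => i _; rewrite /degree [leRHS](bigID (mem (~: S))) /= lerDl.
by apply: sumr_ge0 => *; exact: weight_ge0.
Qed.

Lemma ncut_gt0 : (1 < #|P|)%N -> 0 < ncut G P.
Proof.
move=> /card_gt1P[S [T [SP TP ST]]].
have cut0 U : 0 <= cut G U (~: U) / vol G U.
  apply: divr_ge0; apply: sumr_ge0 => i _; last by rewrite ltW // degree_gt0.
  by apply: sumr_ge0 => *; exact: weight_ge0.
rewrite /ncut (bigD1 S) //= ltr_pwDl ?sumr_ge0 //.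
have [[x xS] [y yT]] := (block_has SP, block_has TP).
rewrite divr_gt0 ?(vol_gt0 xS) // (cut_gt0 (y := y) xS) //.
by apply: contra ST => yS; rewrite (block_uniq SP TP yS yT).
Qed.

Lemma ncut_le_card : ncut G P <= #|P|%:R.
Proof.
rewrite -sum1_card natr_sum; apply: ler_sum => S SP.
have [x xS] := block_has SP.
by rewrite ler_pdivrMr ?(vol_gt0 xS) // mul1r cut_le_vol.
Qed.

End Graph.

(** * Choice of the comparison matrix and the resulting bound *)

Theorem proposition4p5 (R : realType) (n : nat) (G : wgraph R n)
    (hn : (3 <= n)%N) (hG : connected_graph G)
    (m : nat) (P : {set {set 'I_n}})
    (hP : partition P [set: 'I_n]) (hcard : #|P| = m)
    (hm : (2 <= m <= n - 1)%N)
    (pi : 'rV[R]_n) (hpi : stationary (transition_mx G) pi) (j : 'I_n) :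
  (0 < ncut G P < n%:R) /\ kemeny G pi j >= Fbound n m (ncut G P).
Proof.
have n1 : (1 < n)%N by apply: leq_trans hn.
have [m1 mn] : (1 < m)%N /\ (m < n)%N.
  by case/andP: hm => -> h; split=> //; rewrite -(ltn_predK n1) ltnS -subn1.
have x0 : 0 < ncut G P by apply: ncut_gt0; rewrite ?hcard.
have xn : ncut G P < n%:R.
  apply: le_lt_trans (ncut_le_card n1 hG hP) _; by rewrite hcard ltr_nat.
split; first by rewrite x0.
have Qst := transition_stochastic n1 hG; have Qirr := transition_irreducible n1 hG.
have pi1 := mulmx_stationary1 hpi; have Q1 := stochastic_mul1 Qst.
have [Z BZ trZ] := fundamental_mx_trace Qst Qirr hpi.
rewrite /kemeny trZ; set x := ncut G P in x0 xn *.
pose J : 'M[R]_n := const_mx 1 *m pi; pose L := 1%:M - transition_mx G.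
pose Pi := block_proj G P.
have LJ : L *m J = 0 by rewrite mulmxA mulmxBl mul1mx Q1 subrr mul0mx.
have JJ : J *m J = J by rewrite mulmxA -[_ *m pi *m _]mulmxA pi1 mulmx1.
have PJ : Pi *m J = J by rewrite mulmxA block_proj1.
have JP : J *m Pi = J by rewrite -mulmxA stationary_block_proj.
have PP : Pi *m Pi = Pi by exact: block_proj_idem.
have trJ : \tr J = 1 by rewrite mxtrace_mulC pi1 mxtrace1.
have trL : \tr L = n%:R.
  rewrite raddfB /= mxtrace1 [X in _ - X]big1 ?subr0 // => i _.
  by rewrite transition_mxE // weight_loopless mul0r.
have DJ := degree_rank1 n1 hG hpi.
have DJt : (degree_mx G *m J)^T = degree_mx G *m J.
  by rewrite DJ linearZ /= trmx_mul trmxK.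
have DPt := degree_block_proj_sym G P.
have Dt : (degree_mx G)^T = degree_mx G by exact: tr_diag_mx.
have DL : degree_mx G *m L = degree_mx G - weight G.
  by rewrite mulmxBr mulmx1 degree_transition.
(* [a] and [b] maximize the two concave quadratics of [projection_trace]. The maxima are the two
   terms of [Fbound], and the remaining 1 absorbs the [- 1] of [kemeny]. *)
pose a := (m%:R - 1) / x; pose b := (n%:R - m%:R) / (n%:R - x).
have := @selfadjoint_inverse_trace_ge _ _ (\row_i degree G i) (L + J)
  (J + a *: (Pi - J) + b *: (1%:M - Pi)) Z.
rewrite projection_trace // trace_laplacian_block_proj // trace_block_proj // hcard -/x.
have -> : 1 + (2 * a * (m%:R - 1) - a ^+ 2 * x) +
  (2 * b * (n%:R - m%:R) - b ^+ 2 * (n%:R - x)) = 1 + Fbound n m x.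
  by rewrite /a /b /Fbound; field; rewrite subr_eq0 !gt_eqF.
move=> bound; rewrite lerBrDl; apply: bound => //.
- by move=> i; rewrite mxE degree_gt0.
- rewrite mulmxDr DL linearD /= DJt linearB /= Dt; congr (_ - _ + _).
  by apply/matrixP => k l; rewrite mxE weight_sym.
(* The form at [u] is the Dirichlet energy plus [vol G [set: 'I_n]] times the square of
   [pi *m u]. *)
- move=> u; rewrite mulmxDr DL mulmxDr mulmxDl mxE addr_ge0 ?dirichlet_ge0 //.
  rewrite DJ -scalemxAr -scalemxAl mxE mulr_ge0 //.
    by rewrite sumr_ge0 // => i _; rewrite ltW // degree_gt0.
  have -> : u^T *m (pi^T *m pi) *m u = (pi *m u)^T *m (pi *m u).
    by rewrite trmx_mul !mulmxA.
  rewrite [X in 0 <= X]mxE big_ord1 [_^T _ _]mxE.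
  by rewrite -expr2 sqr_ge0.
- rewrite !mulmxDr -!scalemxAr !(mulmxDr, mulmxN) mulmx1.
  by rewrite !(linearD, linearZ, linearN) /= DJt DPt Dt -!scalerDr.
Qed.
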